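(* Let $(T_t)_{t\in\mathbb{R}}$ be an ergodic flow on a probability space $(X,m)$ that preserves the measure $m$, and let $P_n=\int_{\mathbb{R}} T_t\, d\nu_n(t)$, $n\ge 1$, be a sequence of operators, where $\nu_n$ are normalized Borel measures on $\mathbb{R}$. Then for any sequence $a_n\to +0$, any set $A'\subset X$ of positive measure, and any $\varepsilon>0$, there exists a measurable set $A\subset X$ with $m(A'\Delta A)<\varepsilon$ such that $$\left|\left\{n\,:\ \left\|P_n\mathbf{1}_A-m(A)\right\|>a_n\right\}\right|=\infty .$$
   Context: A sequence $a_n\to+0$ is a sequence of positive real numbers tending to $0$. A normalized Borel measure on $\mathbb{R}$ is a (nonnegative) Borel measure $\nu$ with $\nu(\mathbb{R})=1$. The flow acts on functions by $T_tf(x)=f(T_tx)$, so $P_nf(x)=\int_{\mathbb{R}} f(T_tx)\,d\nu_n(t)$. The norm $\|\cdot\|$ is the norm of $L_1(X,m)$, $\mathbf{1}_A$ is the indicator function of $A$, $m(A)$ inside the norm denotes the constant function with that value, $\Delta$ denotes symmetric difference, and $|\cdot|$ applied to a set denotes its cardinality.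
   Formalization: The flow is also assumed aperiodic: for no t ≠ 0 is T_t the identity modulo null sets. Otherwise the claim fails, e.g. for the one-point space, or for translations of R/Z with every ν_n uniform on [0,1], where P_n 1_A = m(A). *)

(* Defs.v *)
From HB Require Import structures.
From mathcomp Require Import all_boot all_order all_algebra.
From mathcomp Require Import all_classical all_reals all_analysis.

Set Implicit Arguments.
Unset Strict Implicit.
Unset Printing Implicit Defensive.

Import Order.TTheory GRing.Theory Num.Theory.
Import numFieldNormedType.Exports.

Local Open Scope classical_set_scope.
Local Open Scope ring_scope.

Section Flows.
Context (R : realType) (d : measure_display) (X : measurableType d).
Implicit Types (T : R -> X -> X) (m : probability X R).

(* [measurableTypeR R] is R with its Borel sigma-algebra. *)
Definition measurable_flow T : Prop :=
  [/\ measurable_fun [set: measurableTypeR R * X] (fun p => T p.1 p.2),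
      forall x, T 0 x = x
    & forall s t x, T (s + t) x = T s (T t x)].

Definition preserves_measure m T : Prop :=
  forall t A, measurable A -> m (T t @^-1` A) = m A.

Definition ergodic_flow m T : Prop :=
  forall A, measurable A -> (forall t, T t @^-1` A = A) ->
    m A = 0%E \/ m A = 1%E.

(* No T t with t != 0 is the identity modulo null sets. Among ergodic flows
   this rules out exactly those whose measure algebra is that of a point or of
   the translation flow on a circle R / cZ; in the latter case averaging over
   the uniform measure on [0, c] maps every f to the constant \int f. On a
   standard space it says that almost every orbit is free. *)
Definition aperiodic_flow m T : Prop :=
  forall t, t != 0 ->
    exists2 A, measurable A & (0 < m (A `+` (T t @^-1` A)))%E.

Definition flow_average (nu : probability (measurableTypeR R) R) T
    (f : X -> R) (x : X) : R :=
  \int[nu]_(t in setT) f (T t x).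

End Flows.

(* Main.v *)
Require Import Defs.
From HB Require Import structures.
From mathcomp Require Import all_boot all_order all_algebra.
From mathcomp Require Import all_classical all_reals all_analysis.
From mathcomp Require Import measurable_realfun ring lra.
Import Order.TTheory GRing.Theory Num.Theory.
Import numFieldNormedType.Exports.
Local Open Scope classical_set_scope.
Local Open Scope ring_scope.

(** Write disc_n(A) for the L1 distance from P_n 1_A to the constant m(A).

    Gliding hump.  Since 1_D = 1_(A U D) - 1_(A \ D), the two sets A U D and
    A \ D satisfy disc_n(D) <= disc_n(A U D) + disc_n(A \ D)
    ([discrepancy_setU_setD]).  Hence, if D has small measure and
    disc_n(D) > 2 a_n, one of them is a small perturbation of A at which the
    bound a_n fails, and as disc_n is Lipschitz for the pseudometric
    m(A + B) of the symmetric difference ([discrepancy_setY]) the bound still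
    fails on a whole neighbourhood.  Repeating this with larger and larger n
    and rapidly shrinking neighbourhoods gives a sequence of sets whose limit
    violates the bound infinitely often.

    What has to be found is, for each small c > 0 and arbitrarily large n, a
    set D of measure between c and 3c with disc_n(D) >= c/4, which exceeds
    2 a_n for large n because a_n -> 0.  The measure nu_n gives mass at least 1 - c/2 to
    some interval |t| < L.  Suppose that the set V of points whose orbit meets
    D at some time |t| < L has measure at most 1/2.  Outside V the average
    P_n 1_D is at most c/2, well below m(D), so the discrepancy is large
    ([discrepancy_lower]).  Such a D exists for all c and L ([thin_set]):
    starting from a set A of positive measure that no orbit revisits at a
    time in [L, 4LN], the points that reach A within time L form a set with N
    disjoint translates, hence of measure at most 1/N ([no_return_hit]).
    Doubling the time at most triples the measure ([hit_double]), and
    ergodicity forces the measure up to 1 ([hit_cvg]), so that some doubling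
    lands between c and 3c; this is D, and the next doubling V has measure at
    most 9c.

    The set A comes from aperiodicity ([no_return_set]).  For one time t <> 0
    a set moved by T_t is at hand, but a continuum of times must be avoided.
    Sliding-window averages of an indicator along orbits are Lipschitz in
    time, and some window average f differs from f o T_t on a set of positive
    measure ([window_displaced]), because the windows determine a set of times
    up to a null set.  Then the set where f is close to a constant while
    f o T_t is far from f avoids its own preimages under T_s for all s in a
    neighbourhood of t.  By compactness finitely many times t suffice for
    [L, 4LN], and by ergodicity suitable translates of the corresponding sets
    have an intersection of positive measure ([orbit_open_meet]).

    All sets built along the flow have open sets of visiting times.  This lets
    rational times stand for real ones, so that the set of points whose orbit
    hits a given set within a given time is measurable. *)

Set Implicit Arguments.
Unset Strict Implicit.
Unset Printing Implicit Defensive.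

(** * Measures of sets *)

Lemma measurable_setY d (X : measurableType d) (A B : set X) :
  measurable A -> measurable B -> measurable (A `+` B).
Proof.
by move=> mA mB; rewrite setY_def; apply: measurableU; exact: measurableD.
Qed.

Lemma bigcup_measure_gt0 d (X : measurableType d) (R : realType)
    (mu : {measure set X -> \bar R}) (I : countType) (F : I -> set X) :
  (forall i, measurable (F i)) -> (0 < mu (\bigcup_i F i))%E ->
  exists i, (0 < mu (F i))%E.
Proof.
move=> mF; apply: contraPP => /forallNP F0; apply/negP; rewrite -leNgt.
pose G n := if unpickle n is Some i then F i else set0.
have mG n : measurable (G n) by rewrite /G; case: unpickle.
have -> : \bigcup_i F i = \bigcup_n G n.
  apply/seteqP; split=> [x [i _ Fix]|x [n _]].
    by exists (pickle i) => //; rewrite /G pickleK.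
  by rewrite /G; case: unpickle => // i Fix; exists i.
apply: le_trans (generalized_Boole_inequality _ mG _) _.
  exact: bigcupT_measurable.
rewrite eseries0// => n _ _; rewrite /G; case: unpickle => [i|]; last first.
  by rewrite measure0.
by apply/eqP; rewrite eq_le measure_ge0 andbT leNgt; apply/negP/F0.
Qed.

Section Probability.
Context d (X : measurableType d) (R : realType) (P : probability X R).

Lemma fine_prob_setU A D : measurable A -> measurable D -> A `&` D = set0 ->
  fine (P (A `|` D)) = fine (P A) + fine (P D).
Proof. by move=> mA mD AD0; rewrite measureU// fineD ?fin_num_measure. Qed.

Lemma le_fine_prob A B : measurable A -> measurable B -> A `<=` B ->
  fine (P A) <= fine (P B).
Proof.
move=> mA mB AB; rewrite fine_le ?fin_num_measure//.
by rewrite le_measure ?inE.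
Qed.

Lemma fine_prob_ge0 A : 0 <= fine (P A).
Proof. exact: fine_ge0. Qed.

Lemma fine_prob_setU_setD A D : measurable A -> measurable D ->
  fine (P (A `|` D)) = fine (P (A `\` D)) + fine (P D).
Proof.
move=> mA mD; rewrite -fine_prob_setU//; last 2 first.
- exact: measurableD.
- by apply/seteqP; split=> x //= [[_]].
by congr (fine (P _)); apply/seteqP; split=> x /=; have [] := pselect (D x); tauto.
Qed.

Lemma fine_prob_setY A B : measurable A -> measurable B ->
  `|fine (P A) - fine (P B)| <= fine (P (A `+` B)).
Proof.
move=> mA mB; have mY := measurable_setY mA mB.
have H U V : measurable U -> measurable V ->
    fine (P U) <= fine (P V) + fine (P (U `+` V)).
  move=> mU mV; have mUV := measurable_setY mU mV.
  have -> : fine (P (U `+` V)) = fine (P (U `\` V)) + fine (P (V `\` U)).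
    rewrite setY_def fine_prob_setU//; try exact: measurableD.
    by apply/seteqP; split=> x //= [[Ux _] []].
  have := fine_prob_setU_setD mU mV.
  have := le_fine_prob mU (measurableU _ _ mU mV) (@subsetUl _ _ _).
  by have := fine_prob_ge0 (V `\` U); lra.
have := H A B mA mB; have := H B A mB mA; rewrite (setYC B A).
by rewrite ler_norml => *; apply/andP; split; lra.
Qed.

Lemma measurable_lim_sup_set (F : (set X)^nat) : (forall k, measurable (F k)) ->
  measurable (lim_sup_set F).
Proof.
move=> mF; apply: bigcapT_measurable => n.
by apply: bigcup_measurable => k _; exact: mF.
Qed.

(** A point that never changes its membership after step k belongs to the
    upper limit exactly when it belongs to [F k]. *)
Lemma setY_lim_sup_set (F : (set X)^nat) k :
  F k `+` lim_sup_set F `<=` \bigcup_j (F (k + j)%N `+` F (k + j.+1)%N).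
Proof.
move=> x; apply: contraPP => nY.
have E j : F (k + j)%N x <-> F k x.
  elim: j => [|j IH]; first by rewrite addn0.
  apply: iff_trans IH; have : ~ (F (k + j)%N `+` F (k + j.+1)%N) x.
    by move=> h; apply: nY; exists j.
  rewrite setY_def => /not_orP[/not_andP h1 /not_andP h2].
  by split=> h; [case: h2 => // /contrapT|case: h1 => // /contrapT].
have {}E i : (k <= i)%N -> F i x <-> F k x by move=> /subnKC <-; exact: E.
rewrite setY_def => -[[Fk]|[Fs nFk]].
  apply=> n _; exists (maxn n k); first exact: leq_maxl.
  by apply/E => //; exact: leq_maxr.
by have [i ki Fi] := Fs k I; apply: nFk; apply/(E i).
Qed.

(** Completeness of the measure algebra, for sequences whose successive
    distances decrease geometrically. *)
Lemma lim_sup_set_near (F : (set X)^nat) (r : R) k : (forall i, measurable (F i)) ->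
  (forall j, fine (P (F (k + j)%N `+` F (k + j.+1)%N)) <= r / 2 ^+ j.+1) ->
  0 <= r -> fine (P (F k `+` lim_sup_set F)) <= r.
Proof.
move=> mF Fr r0; have mL := measurable_lim_sup_set mF.
pose G j := F (k + j)%N `+` F (k + j.+1)%N.
have mG j : measurable (G j) by exact: measurable_setY.
have mU : measurable (\bigcup_j G j) by exact: bigcupT_measurable.
have mY := measurable_setY (mF k) mL.
rewrite -lee_fin fineK ?fin_num_measure//.
apply: (@le_trans _ _ (P (\bigcup_j G j))).
  by apply: le_measure; rewrite ?inE//; exact: setY_lim_sup_set.
apply: le_trans (generalized_Boole_inequality P mG mU) _.
apply: le_trans (epsilon_trick0 xpredT r0).
apply: lee_nneseries => // j _.
suff : (P (G j) <= (r / (2 ^ j.+1)%:R)%:E)%E by [].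
by rewrite -[P _]fineK ?fin_num_measure// lee_fin natrX; exact: Fr.
Qed.

End Probability.

(** * Sets of times *)

Section Times.
Context {R : realType}.
Local Notation RB := (measurableTypeR R).
Local Notation leb := (@lebesgue_measure R).
Implicit Types (S : set RB) (p q a b u L : R).

Lemma measurable_itvRB (i : interval R) : measurable ([set` i] : set RB).
Proof. exact: measurable_itv. Qed.

Lemma measurable_far L : measurable ([set t | L <= `|t|] : set RB).
Proof.
rewrite (_ : [set t | _] = ~` `]- L, L[%classic).
  by apply: measurableC; exact: measurable_itvRB.
apply/seteqP; split=> t; rewrite /= in_itv/= -ltr_norml ltNge.
  by move=> Lt /negP.
by move=> /negP; rewrite negbK.
Qed.

Lemma tight (nu : probability RB R) (e : R) :
  0 < e -> exists2 L, 0 < L & (nu [set t : R | (L <= `|t|)%R] <= e%:E)%E.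
Proof.
move=> e0; pose F n := [set t : R | n.+1%:R <= `|t|].
have mF n : measurable (F n : set RB) by exact: measurable_far.
have F0 : \bigcap_n F n = set0.
  apply/seteqP; split=> // t /(_ (Num.truncn `|t|) I); rewrite /F/= leNgt.
  by rewrite truncnS_gt.
have := @nonincreasing_cvg_mu _ _ _ nu F _ mF.
rewrite F0 measure0 => cv.
have : (fun n => nu (F n)) @ \oo --> 0%E.
  apply: cv => //; first by rewrite ltey_eq fin_num_measure.
  move=> n k nk; apply/subsetPset => t; rewrite /F/=; apply: le_trans.
  by rewrite ler_nat.
have nb : nbhs (0%E : \bar R) [set y | (y < e%:E)%E].
  by apply: open_nbhs_nbhs; split; [exact: open_ereal_lt_ereal|rewrite /= lte_fin].
move=> /(_ _ nb)[n _ /(_ n (leqnn n))]/= h.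
by exists n.+1%:R => //; exact: ltW.
Qed.

Lemma measurable_translation u :
  measurable_fun [set: RB] ((fun t : R => t + u) : RB -> RB).
Proof.
apply: continuous_measurable_fun => t.
by apply: continuousD => //; exact: cvg_cst.
Qed.

Lemma lebesgue_measure_translation u S : measurable S ->
  leb ((fun t : R => t + u) @^-1` S) = leb S.
Proof.
move=> mS; have mu := measurable_translation u.
rewrite -[LHS]/(pushforward leb ((fun t : R => t + u) : RB -> RB) S).
apply/esym/lebesgue_measure_unique => //= _ [[a b]] _ <-.
rewrite /pushforward [X in _ = leb X](_ : _ = `]a - u, b - u]%classic); last first.
  by apply/seteqP; split=> t /=; rewrite !in_itv/=; lra.
rewrite !lebesgue_measure_itv/= !lte_fin ltrD2r; case: ifP => // _.
by rewrite -!EFinB; congr EFin; lra.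
Qed.

Lemma lebesgue_measure_setT : leb setT = +oo%E.
Proof. by rewrite -set_itvNyy lebesgue_measure_itv. Qed.

Definition window S p q : R := fine (leb (`]p, q] `&` S)).

Lemma lebesgue_itvoc_le p q : (leb (`]p, q] : set R) <= `|q - p|%:E)%E.
Proof.
rewrite lebesgue_measure_itv/= lte_fin; case: ifP => // pq.
by rewrite -EFinB lee_fin ler_norm.
Qed.

Lemma measurable_window S p q : measurable S ->
  measurable (`]p, q] `&` S : set RB).
Proof. by move=> mS; apply: measurableI => //; exact: measurable_itvRB. Qed.

Lemma windowE S p q : measurable S -> leb (`]p, q] `&` S) = (window S p q)%:E.
Proof.
move=> mS; rewrite fineK// ge0_fin_numE//.
apply: (@le_lt_trans _ _ (leb (`]p, q] : set R))).
  by apply: le_measure; rewrite ?inE//; exact: measurable_window.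
by apply: le_lt_trans (lebesgue_itvoc_le _ _) _; rewrite ltry.
Qed.

(** This single estimate gives both the Lipschitz dependence on time of the
    window averages along an orbit and the passage from windows with rational
    end points to all windows. *)
Lemma window_le S p q a b : measurable S ->
  window S a b <= window S p q + `|p - a| + `|b - q|.
Proof.
move=> mS; rewrite -lee_fin !EFinD -!windowE//.
apply: (@le_trans _ _ (leb (((`]p, q] `&` S) `|` `]a, p]) `|` `]q, b]))%E).
  apply: le_measure; rewrite ?inE; first exact: measurable_window.
    apply: measurableU; last exact: measurable_itvRB.
    by apply: measurableU; [exact: measurable_window|exact: measurable_itvRB].
  move=> t /= []; rewrite !in_itv/= => /andP[at_ tb] St.
  have [tp|pt] := leP t p; first by left; right; lra.
  have [tq|qt] := leP t q; first by left; left; split => //; lra.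
  by right; lra.
have mp := measurable_window p q mS.
have ma : measurable (`]a, p]%classic : set RB) by exact: measurable_itvRB.
have mb : measurable (`]q, b]%classic : set RB) by exact: measurable_itvRB.
apply: le_trans (measureU2 _ _ _) _ => //; first exact: measurableU.
apply: leeD; last exact: lebesgue_itvoc_le.
apply: le_trans (measureU2 _ _ _) _ => //.
by apply: leeD => //; exact: lebesgue_itvoc_le.
Qed.

Lemma window_translation S u p q : measurable S ->
  window ((fun t : R => t + u) @^-1` S) p q = window S (p + u) (q + u).
Proof.
move=> mS; rewrite /window -[in RHS](lebesgue_measure_translation u); last first.
  exact: measurable_window.
congr (fine (leb _)); apply/seteqP.
by split=> t /= []; rewrite !in_itv/= => tpq St; split => //; lra.
Qed.

(** Countably many windows see every difference of positive measure: half-open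
    intervals form a pi-system generating the Borel sets, so the restrictions
    of Lebesgue measure to [S] and to [S'] coincide, and only the first one
    can charge the difference. *)
Lemma window_rat_eq S S' : measurable S -> measurable S' ->
  (forall p q : rat, window S (ratr p) (ratr q) = window S' (ratr p) (ratr q)) ->
  leb (S `\` S') = 0%E.
Proof.
move=> mS mS' E.
have le U V a b : measurable U -> measurable V ->
    (forall p q : rat, window U (ratr p) (ratr q) = window V (ratr p) (ratr q)) ->
    window U a b <= window V a b.
  move=> mU mV {}E; apply/ler_addgt0Pr => e e0.
  have [p] := @rat_in_itvoo R (a - e / 4) a ltac:(lra).
  have [q] := @rat_in_itvoo R (b - e / 4) b ltac:(lra).
  rewrite !in_itv/= => hq hp.
  have h1 := window_le (ratr p) (ratr q) a b mU.
  have h2 := window_le a b (ratr p) (ratr q) mV.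
  rewrite E in h1.
  have ep : `|ratr p - a| <= e / 4 by rewrite ler_norml; lra.
  have eq : `|b - ratr q| <= e / 4 by rewrite ler_norml; lra.
  rewrite (distrC a) (distrC (ratr q)) in h2; lra.
have eqW a b : window S a b = window S' a b.
  by apply/eqP; rewrite eq_le !le.
have mD := measurableD mS mS'.
pose m1 : {measure set RB -> \bar R} := mrestr leb mS.
pose m2 : {measure set RB -> \bar R} := mrestr leb mS'.
have : m1 (S `\` S') = m2 (S `\` S').
  apply: (@measure_unique _ R RB (@ocitv R)
    (fun k => `](- k%:R), k%:R]%classic)) => //.
  - exact: ocitvI.
  - by move=> k; exact: is_ocitv.
  - apply/seteqP; split=> // t _; exists (Num.truncn `|t|).+1 => //=.
    have := truncnS_gt `|t|; rewrite ltr_norml in_itv/=; lra.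
  - by move=> _ [[a b] _ <-]; rewrite /= /mrestr !windowE// eqW.
  - by move=> k; rewrite /= /mrestr windowE// ltry.
rewrite /m1 /m2 /= /mrestr.
have -> : (S `\` S') `&` S = S `\` S' by apply: setIidl => t [].
move=> ->; have -> : (S `\` S') `&` S' = set0.
  by apply/seteqP; split=> t // [[]].
exact: measure0.
Qed.

End Times.

Section Flow.
Context (R : realType) (d : measure_display) (X : measurableType d).
Variables (m : probability X R) (T : R -> X -> X).
Hypotheses (T_flow : measurable_flow T) (T_pres : preserves_measure m T).
Local Notation RB := (measurableTypeR R).
Local Notation leb := (@lebesgue_measure R).
Implicit Types (A B D V E : set X) (nu : probability RB R).

Lemma flow0 x : T 0 x = x.
Proof. by have [_ ->] := T_flow. Qed.

Lemma flowD s t x : T (s + t) x = T s (T t x).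
Proof. by have [_ _ ->] := T_flow. Qed.

Lemma measurable_act t : measurable_fun setT (T t).
Proof.
have [mT _ _] := T_flow.
apply: (measurableT_comp mT (g := fun x => (t : RB, x))).
exact: pair1_measurable.
Qed.

Lemma measurable_preimage_act t A : measurable A -> measurable (T t @^-1` A).
Proof. by move=> mA; rewrite -[_ @^-1` _]setTI; apply: measurable_act. Qed.

(** * Visiting times *)

Definition visits A (x : X) : set RB := [set t | A (T t x)].

Lemma visitsU A B x : visits (A `|` B) x = visits A x `|` visits B x.
Proof. by []. Qed.

Lemma visitsD A B x : visits (A `\` B) x = visits A x `\` visits B x.
Proof. by []. Qed.

Lemma visitsY A B x : visits (A `+` B) x = visits A x `+` visits B x.
Proof. by rewrite !setY_def. Qed.

Lemma visits_act A u x : visits A (T u x) = (fun t : R => t + u) @^-1` visits A x.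
Proof. by apply/seteqP; split=> t; rewrite /visits/= flowD. Qed.

Lemma measurable_flow_graph A : measurable A ->
  measurable [set p : RB * X | A (T p.1 p.2)].
Proof.
move=> mA; have [mT _ _] := T_flow.
by rewrite -[X in measurable X]setTI; apply: mT.
Qed.

Lemma visits_ysection A x :
  visits A x = ysection [set p : RB * X | A (T p.1 p.2)] x.
Proof. by apply/seteqP; split=> t; rewrite /visits /ysection/= in_setE. Qed.

Lemma measurable_visits A x : measurable A -> measurable (visits A x).
Proof.
move=> mA; rewrite visits_ysection; apply: measurable_ysection.
exact: measurable_flow_graph.
Qed.

Section Sojourn.
Variable mu : {sigma_finite_measure set RB -> \bar R}.

Lemma measurable_sojourn A : measurable A ->
  measurable_fun setT ((fun x => mu (visits A x)) : X -> \bar R).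
Proof.
move=> mA; under eq_fun do rewrite visits_ysection.
by apply: measurable_fun_ysection; exact: measurable_flow_graph.
Qed.

(** Tonelli's theorem, the flow preserving [m] at every single time.  It is
    used both for the averaging probabilities and for Lebesgue measure, where
    the right-hand side is infinite as soon as [A] is not null. *)
Lemma integral_sojourn A : measurable A ->
  (\int[m]_x mu (visits A x) = m A * mu setT)%E.
Proof.
move=> mA; have mE := measurable_flow_graph mA.
have /esym := indic_fubini_tonelli mu m mE.
rewrite indic_fubini_tonelli_FE// indic_fubini_tonelli_GE//=.
under eq_integral do rewrite -visits_ysection.
move=> ->; rewrite -integral_cst//; apply: eq_integral => t _ /=.
rewrite -(T_pres t mA); congr (m _); apply/seteqP.
by split=> x; rewrite /xsection/= in_setE.
Qed.

End Sojourn.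

Lemma integral_sojourn_prob nu A : measurable A ->
  (\int[m]_x nu (visits A x) = m A)%E.
Proof.
move=> mA; rewrite integral_sojourn// -[RHS]mule1.
by congr (_ * _)%E; exact: probability_setT.
Qed.

(** * Discrepancy of a flow average *)

Definition discrepancy nu A : \bar R :=
  'N[m]_1[ (fun x => (flow_average nu T \1_A x - fine (m A))%:E) ]%E.

Lemma flow_average_indic nu A x : measurable A ->
  flow_average nu T \1_A x = fine (nu (visits A x)).
Proof.
move=> mA; rewrite /flow_average /Rintegral; congr fine.
by rewrite -[X in _ = nu X]setIT -integral_indic//; exact: measurable_visits.
Qed.

Lemma discrepancyE nu A : measurable A ->
  discrepancy nu A = (\int[m]_x `|fine (nu (visits A x)) - fine (m A)|%:E)%E.
Proof.
move=> mA; rewrite /discrepancy Lnorm1.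
by apply: eq_integral => x _; rewrite flow_average_indic.
Qed.

Lemma measurable_discrepancy nu A : measurable A ->
  measurable_fun setT (fun x => `|fine (nu (visits A x)) - fine (m A)|%:E).
Proof.
move=> mA; apply/measurable_EFinP/measurableT_comp => //.
apply: measurable_funB => //; apply: (measurableT_comp (f := @fine R)) => //.
exact: (measurable_sojourn nu).
Qed.

Lemma discrepancy_setU_setD nu A D : measurable A -> measurable D ->
  (discrepancy nu D <= discrepancy nu (A `|` D) + discrepancy nu (A `\` D))%E.
Proof.
move=> mA mD.
have mU := measurableU _ _ mA mD; have mB := measurableD mA mD.
rewrite !discrepancyE// -ge0_integralD//; try exact: measurable_discrepancy.
apply: ge0_le_integral => //; first exact: measurable_discrepancy.
  by apply: emeasurable_funD; exact: measurable_discrepancy.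
move=> x _; rewrite -EFinD lee_fin.
have := fine_prob_setU_setD m mA mD.
have := fine_prob_setU_setD nu (measurable_visits x mA) (measurable_visits x mD).
rewrite visitsU visitsD => -> ->.
set u := fine (nu _); set v := fine (nu _); set u' := fine (m _).
set v' := fine (m _); have -> : u - u' = (v + u - (v' + u')) - (v - v') by ring.
exact: ler_normB.
Qed.

(** Changing the set changes both the average and the constant, each by at
    most the measure of the symmetric difference: hence the factor 2. *)
Lemma discrepancy_setY nu A B : measurable A -> measurable B ->
  (discrepancy nu A <= discrepancy nu B + 2%:E * m (A `+` B))%E.
Proof.
move=> mA mB; have mY := measurable_setY mA mB.
have -> : (2%:E * m (A `+` B) =
    \int[m]_x (nu (visits (A `+` B) x) + cst (m (A `+` B)) x))%E.
  rewrite ge0_integralD//; last exact: (measurable_sojourn nu).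
  rewrite integral_cst// integral_sojourn_prob//.
  have -> : (m (A `+` B) * m [set: X] = m (A `+` B))%E.
    by rewrite -[RHS]mule1; congr (_ * _)%E; exact: probability_setT.
  by rewrite mule_natl mule2n.
rewrite !discrepancyE// -ge0_integralD//; first last.
- apply: emeasurable_funD => //; exact: (measurable_sojourn nu).
- by move=> x _; exact: adde_ge0.
- exact: measurable_discrepancy.
apply: ge0_le_integral => //; first exact: measurable_discrepancy.
  apply: emeasurable_funD; first exact: measurable_discrepancy.
  apply: emeasurable_funD => //; exact: (measurable_sojourn nu).
move=> x _ /=.
have := fine_prob_setY m mA mB.
have := fine_prob_setY nu (measurable_visits x mA) (measurable_visits x mB).
have mYx := measurable_visits x mY.
rewrite -visitsY -[m (_ `+` _)]fineK ?fin_num_measure//.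
rewrite -[nu (visits (_ `+` _) _)]fineK ?fin_num_measure//.
rewrite -!EFinD lee_fin.
set a := fine (nu _); set b := fine (nu _); set c := fine (nu _).
set a' := fine (m _); set b' := fine (m _); set c' := fine (m _).
move=> h1 h2.
have -> : a - a' = (b - b') + ((a - b) - (a' - b')) by ring.
apply: le_trans (ler_normD _ _) _; rewrite lerD2l.
by apply: le_trans (ler_normB _ _) _; exact: lerD.
Qed.

(** A point outside [V] visits [D] only at times in [K], to which [nu] gives
    little mass, so its average is below [delta].  As at least half of the
    points are of this kind, the averages cannot be close to [m D]. *)
Lemma discrepancy_lower nu D V (K : set RB) (delta : R) :
  measurable D -> measurable V -> measurable K ->
  (forall x, ~ V x -> visits D x `<=` K) ->
  (nu K <= delta%:E)%E -> fine (m V) <= 2^-1 ->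
  (((fine (m D) - delta) / 2)%:E <= discrepancy nu D)%E.
Proof.
move=> mD mV mK VK Kd mV2.
have [c0|c0] := leP (fine (m D) - delta) 0.
  by apply: (le_trans _ (Lnorm_ge0 _ _ _)); rewrite lee_fin; lra.
rewrite discrepancyE//.
have mVC := measurableC mV.
apply: (@le_trans _ _
    (\int[m]_(x in ~` V) `|fine (nu (visits D x)) - fine (m D)|%:E)%E); last first.
  by apply: ge0_subset_integral => //; exact: measurable_discrepancy.
apply: (@le_trans _ _ (\int[m]_(x in ~` V) cst (fine (m D) - delta)%:E x)%E).
  rewrite integral_cst// [X in (_ <= _ * X)%E](_ : _ = 1 - m V)%E; last first.
    exact: probability_setC.
  rewrite -[m V]fineK ?fin_num_measure// -EFinB -EFinM lee_fin.
  by apply: ler_pM; lra.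
apply: ge0_le_integral => //.
- by move=> x _; rewrite lee_fin ltW.
- exact/measurable_funTS/measurable_discrepancy.
move=> x Vx; rewrite lee_fin.
have mx := measurable_visits x mD.
have : fine (nu (visits D x)) <= delta.
  rewrite -lee_fin fineK ?fin_num_measure//; apply: le_trans Kd.
  by apply: le_measure; rewrite ?inE//; exact: VK.
by rewrite distrC => h; apply: le_trans (ler_norm _); lra.
Qed.

(** * Orbit-open sets and the points that reach them *)

(** Measurable sets that are open in the leaf topology of the orbits, where
    a neighbourhood of [x] is a short piece of its orbit. *)
Definition orbit_open A := measurable A /\ forall x, open (visits A x : set R).

Definition hit A (S : R) : set X := [set x | exists2 t, `|t| < S & A (T t x)].

Definition no_return A (J : set R) := forall x t, J t -> A x -> ~ A (T t x).

Lemma orbit_open_rat A x (U : set R) : orbit_open A -> open U ->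
  (exists2 t, U t & A (T t x)) -> exists2 q : rat, U (ratr q) & A (T (ratr q) x).
Proof.
move=> [_ oA] oU [t Ut At].
have [|y [[Uy Ay] [q _ qE]]] := @dense_rat R (U `&` visits A x) _ (openI oU (oA x)).
  by exists t.
by exists q; rewrite qE.
Qed.

Lemma orbit_openI A B : orbit_open A -> orbit_open B -> orbit_open (A `&` B).
Proof.
move=> [mA oA] [mB oB]; split; first exact: measurableI.
by move=> x; exact: openI (oA x) (oB x).
Qed.

Lemma orbit_open_preimage A s : orbit_open A -> orbit_open (T s @^-1` A).
Proof.
move=> [mA oA]; split; first exact: measurable_preimage_act.
move=> x; rewrite (_ : _ x = (fun t : R => s + t) @^-1` visits A x).
  apply: open_comp => // t _; apply: continuousD => //; exact: cvg_cst.
by apply/seteqP; split => t; rewrite /visits/= flowD.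
Qed.

(** An uncountable union of preimages, which openness along orbits reduces to
    the union over rational times. *)
Lemma measurable_hit A S : orbit_open A -> measurable (hit A S).
Proof.
move=> oA; have mA := oA.1.
rewrite (_ : hit A S = \bigcup_(q : rat)
    (if `|ratr q : R| < S then T (ratr q) @^-1` A else set0)).
  apply: bigcupT_measurable_rat => q; case: ifP => // _.
  exact: measurable_preimage_act.
apply/seteqP; split=> [x [t tS At]|x [q _]].
  have [||q qS Aq] := @orbit_open_rat A x (ball (0 : R) S) oA.
  - exact: ball_open.
  - by exists t => //; rewrite /ball/= sub0r normrN.
  by exists q => //; move: qS; rewrite /ball/= sub0r normrN => ->.
by case: ifP => // qS Aq; exists (ratr q).
Qed.

Lemma hit_preimage A S s : T s @^-1` hit A S `<=` hit A (S + `|s|).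
Proof.
move=> x [t tS At]; exists (t + s); last by rewrite flowD.
by apply: le_lt_trans (ler_normD _ _) _; rewrite ltrD2r.
Qed.

Lemma le_hit A : {homo hit A : S S' / S <= S' >-> S `<=` S'}.
Proof. by move=> S S' SS' x [t tS At]; exists t => //; exact: lt_le_trans SS'. Qed.

(** An orbit reaching [A] within time [2 * S] does so within time [S] after
    being moved by [S], by [- S] or not at all. *)
Lemma hit_double A S : orbit_open A ->
  fine (m (hit A (2 * S))) <= 3 * fine (m (hit A S)).
Proof.
move=> oA; have mS := measurable_hit S oA; have m2S := measurable_hit (2 * S) oA.
pose H s := T s @^-1` hit A S.
have mH s : measurable (H s) by exact: measurable_preimage_act.
have mHE s : fine (m (H s)) = fine (m (hit A S)) by rewrite T_pres.
have mU := measurableU _ _ (mH S) (mH (- S)).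
have : hit A (2 * S) `<=` (H S `|` H (- S)) `|` H 0.
  move=> x [t]; rewrite ltr_norml => tS At.
  have [t0|t0|t0] := ltgtP t 0.
  - left; right; exists (t + S); last by rewrite -flowD addrK.
    by rewrite ltr_norml; lra.
  - left; left; exists (t - S); last by rewrite -flowD subrK.
    by rewrite ltr_norml; lra.
  - by right; exists 0; [rewrite normr0; lra|rewrite !flow0 -[x]flow0 -t0].
move=> /(le_fine_prob m m2S (measurableU _ _ mU (mH 0))).
have := fine_prob_setU_setD m mU (mH 0).
have := fine_prob_setU_setD m (mH S) (mH (- S)).
have := le_fine_prob m (measurableD mU (mH 0)) mU (@subDsetl _ _ _).
have := le_fine_prob m (measurableD (mH S) (mH (- S))) (mH S) (@subDsetl _ _ _).
rewrite !mHE; lra.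
Qed.

(** The preimages of [hit A L] under the times [4 * L * i] with [i < N] are
    pairwise disjoint: a common point of two of them would visit [A] twice,
    at times that differ by at least [4 * L - 2 * L] and by less than
    [4 * L * (N - 1) + 2 * L]. *)
Lemma no_return_hit A (L : R) N : orbit_open A -> 0 < L ->
  no_return A [set t | L <= t <= 4 * L * N%:R] -> N%:R * fine (m (hit A L)) <= 1.
Proof.
move=> oA L0 nrA; have mL := measurable_hit L oA.
pose F i := T (4 * L * i%:R) @^-1` hit A L.
have mF i : measurable (F i) by exact: measurable_preimage_act.
have FP i j x : (i < j < N)%N -> F i x -> F j x -> False.
  move=> /andP[ij jN] [s sL As] [t tL At].
  move: As At; rewrite -!flowD; set u := s + _; set v := t + _ => Au Av.
  apply: (nrA (T u x) (v - u) _ Au); last by rewrite -flowD subrK.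
  have ijR : i%:R + 1 <= j%:R :> R by rewrite natr1 ler_nat.
  have jNR : j%:R + 1 <= N%:R :> R by rewrite natr1 ler_nat.
  have i0 : 0 <= i%:R :> R by [].
  move: sL tL; rewrite !ltr_norml /= /u /v; nra.
have tF : trivIset [set: 'I_N] (fun i : 'I_N => F i).
  apply/trivIsetP => i j _ _ ij; apply/seteqP; split=> // x [Fi Fj].
  move: ij; rewrite -val_eqE neq_ltn => /orP[ij|ij].
    by apply: (FP i j x) => //; rewrite ij ltn_ord.
  by apply: (FP j i x) => //; rewrite ij ltn_ord.
have mU : measurable (\big[setU/set0]_(i < N) F i) by exact: bigsetU_measurable.
have := probability_le1 m mU.
rewrite measure_bigsetU_ord//.
rewrite (eq_bigr (fun=> (fine (m (hit A L)))%:E)); last first.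
  by move=> i _; rewrite fineK ?fin_num_measure//; exact: T_pres.
by rewrite sumEFin lee_fin sumr_const card_ord -[_ *+ _]mulr_natl.
Qed.

Section Ergodic.
Hypothesis T_erg : ergodic_flow m T.

Lemma hit_full A : orbit_open A -> (0 < m A)%E -> m (\bigcup_n hit A n%:R) = 1%E.
Proof.
move=> oA A0; set U := \bigcup_n _.
have mU : measurable U by apply: bigcupT_measurable => n; exact: measurable_hit.
have UE x : U x <-> exists t, A (T t x).
  split=> [[n _ [t _ At]]|[t At]]; first by exists t.
  exists (Num.truncn `|t|).+1 => //; exists t => //.
  exact: truncnS_gt.
have AU : A `<=` U by move=> x Ax; apply/UE; exists 0; rewrite flow0.
have [t||//] := T_erg mU.
  apply/seteqP; split=> x /UE[s As]; apply/UE.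
    by exists (s + t); rewrite flowD.
  by exists (s - t); rewrite -flowD subrK.
move=> U0; move: A0; rewrite lt_neqAle => /andP[/eqP A0 _]; exfalso; apply: A0.
by apply/esym; apply: subset_measure0 U0 => //; exact: oA.1.
Qed.

Lemma hit_cvg A (S : nat -> R) : orbit_open A -> (0 < m A)%E ->
  nondecreasing_seq S -> (forall r, exists n, r <= S n) ->
  forall c, c < 1 -> exists n, c < fine (m (hit A (S n))).
Proof.
move=> oA A0 ndS cofS c c1.
have mS n := measurable_hit (S n) oA.
have mU : measurable (\bigcup_n hit A (S n)) by exact: bigcupT_measurable.
have U1 : m (\bigcup_n hit A (S n)) = 1%E.
  apply/eqP; rewrite eq_le probability_le1//= -(hit_full oA A0).
  apply: le_measure; rewrite ?inE//.
    by apply: bigcupT_measurable => n; exact: measurable_hit.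
  move=> x [k _ xk]; have [n kn] := cofS k%:R.
  by exists n => //; exact: le_hit xk.
have ndF : nondecreasing_seq (fun n => hit A (S n)).
  by move=> n k nk; apply/subsetPset/le_hit/ndS.
have := nondecreasing_cvg_mu (mu := m) mS mU ndF.
rewrite [X in _ --> X -> _](_ : _ = 1%E)// => cv.
have /cv : nbhs (1%E : \bar R) [set y | (c%:E < y)%E].
  by apply: open_nbhs_nbhs; split; [exact: open_ereal_gt_ereal|rewrite /= lte_fin].
move=> [n _ /(_ n (leqnn n))] /= h.
by exists n; rewrite -lte_fin fineK// fin_num_measure.
Qed.

Lemma orbit_open_meet A B : orbit_open A -> orbit_open B ->
  (0 < m A)%E -> (0 < m B)%E -> exists s, (0 < m (A `&` T s @^-1` B))%E.
Proof.
move=> oA oB A0 B0.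
pose F (q : rat) := A `&` T (ratr q) @^-1` B.
have mF q : measurable (F q).
  by apply: measurableI; [exact: oA.1|apply: measurable_preimage_act oB.1].
suff : (0 < m (\bigcup_q F q))%E.
  by move=> /(bigcup_measure_gt0 mF)[q]; exists (ratr q).
have mU : measurable (\bigcup_n hit B n%:R).
  by apply: bigcupT_measurable => n; exact: measurable_hit.
rewrite (_ : \bigcup_q F q = A `&` \bigcup_n hit B n%:R).
  have mA := oA.1.
  have AU0 : m (A `\` \bigcup_n hit B n%:R) = 0%E.
    apply: (@subset_measure0 _ _ _ m _ (~` (\bigcup_n hit B n%:R))).
    - exact: measurableD.
    - exact: measurableC.
    - by move=> x [].
    - transitivity (1 - m (\bigcup_n hit B n%:R))%E.
        exact: probability_setC.
      by rewrite hit_full// subee.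
  suff <- : m A = m (A `&` \bigcup_n hit B n%:R) by [].
  rewrite -[RHS]add0e -[X in _ = (X + _)%E]AU0; exact: measureDI.
apply/seteqP; split=> x.
  move=> [q _ [Ax Bq]]; split => //.
  exists (Num.truncn `|ratr q : R|).+1 => //.
  by exists (ratr q) => //; exact: truncnS_gt.
move=> [Ax [n _ Bx]].
have [||q _ Bq] := @orbit_open_rat B x setT oB; first exact: openT.
  by case: Bx => t _ Bt; exists t.
by exists q.
Qed.

End Ergodic.

(** * Windows along orbits *)

Lemma window_act_lipschitz A p q u x : measurable A ->
  `|window (visits A (T u x)) p q - window (visits A x) p q| <= 2 * `|u|.
Proof.
move=> mA; have mx := measurable_visits x mA.
rewrite visits_act window_translation//.
have h1 := window_le p q (p + u) (q + u) mx.
have h2 := window_le (p + u) (q + u) p q mx.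
have e1 : p - (p + u) = - u by ring.
have e2 : q + u - q = u by ring.
have e3 : p + u - p = u by ring.
have e4 : q - (q + u) = - u by ring.
move: h1 h2; rewrite e1 e2 e3 e4 normrN ler_norml => h1 h2.
by apply/andP; split; lra.
Qed.

Lemma measurable_fun_window A p q : measurable A ->
  measurable_fun setT (fun x => window (visits A x) p q).
Proof.
move=> mA; apply: (measurableT_comp (f := @fine R)) => //.
pose E : set (RB * X) := (`]p, q]%classic `*` setT) `&` [set z | A (T z.1 z.2)].
have mE : measurable E.
  apply: measurableI; last exact: (measurable_flow_graph mA).
  by apply: measurableX => //; exact: measurable_itvRB.
have -> : (fun x => leb (`]p, q] `&` visits A x)) = leb \o ysection E.
  apply/funext => x /=; congr (leb _).
  by apply/seteqP; split=> t; rewrite /ysection/= in_setE /E/=; [move=> []|move=> [[]]].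
exact: measurable_fun_ysection.
Qed.

(** If no rational window noticed the move by [T t], then almost every orbit
    would spend zero time in the part of [A] that [T t] maps outside [A]; by
    [integral_sojourn] this part would be null, and so would be the symmetric
    difference of [A] and its preimage, which has the same measure. *)
Lemma window_displaced A t : measurable A -> (0 < m (A `+` T t @^-1` A))%E ->
  exists p q, (0 < m [set x | window (visits A (T t x)) p q !=
                              window (visits A x) p q])%E.
Proof.
move=> mA; set B := T t @^-1` A => AB0.
have mB : measurable B by exact: measurable_preimage_act.
have mC := measurableD mA mB.
have C0 : (0 < m (A `\` B))%E.
  rewrite lt0e measure_ge0 andbT; apply/eqP => C0.
  have mD := measurableD mB mA.
  have : fine (m (A `+` B)) = fine (m (A `\` B)) + fine (m (B `\` A)).
    rewrite setY_def fine_prob_setU//.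
    by apply/seteqP; split=> x //= [[Ax _] []].
  have := fine_prob_setU_setD m mA mB.
  have := fine_prob_setU_setD m mB mA; rewrite setUC.
  have : fine (m B) = fine (m A) by rewrite T_pres.
  have : fine (m (A `\` B)) = 0 by rewrite C0.
  have : 0 < fine (m (A `+` B)).
    by rewrite -lte_fin fineK ?fin_num_measure//; exact: measurable_setY.
  lra.
pose F (z : rat * rat) := [set x |
  window (visits A (T t x)) (ratr z.1) (ratr z.2) !=
  window (visits A x) (ratr z.1) (ratr z.2)].
have mF z : measurable (F z).
  have mw := measurable_fun_window (ratr z.1) (ratr z.2) mA.
  have mwt : measurable_fun setT
      (fun x => window (visits A (T t x)) (ratr z.1) (ratr z.2)).
    by apply: (measurableT_comp mw); exact: measurable_act.
  pose h x := window (visits A (T t x)) (ratr z.1) (ratr z.2) -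
              window (visits A x) (ratr z.1) (ratr z.2).
  have -> : F z = setT `&` h @^-1` (~` [set 0]).
    by rewrite setTI; apply/seteqP; split=> x; rewrite /F/= /h -subr_eq0 => /eqP.
  apply: (measurable_funB mwt mw) => //.
  by apply: measurableC; exact: measurable_set1.
suff /(bigcup_measure_gt0 mF)[z] : (0 < m (\bigcup_z F z))%E.
  by exists (ratr z.1), (ratr z.2).
have mU : measurable (\bigcup_z F z) by exact: countable_bigcupT_measurable.
rewrite lt0e measure_ge0 andbT; apply/eqP => U0.
have := integral_sojourn leb mC.
rewrite (ge0_negligible_integral mU)//; last exact: measurable_sojourn.
rewrite integral0_eq//.
  rewrite [X in _ = (_ * X)%E](_ : _ = +oo%E); last exact: lebesgue_measure_setT.
  by rewrite gt0_muley.
move=> x [_ Ux].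
rewrite visitsD; apply: window_rat_eq.
- exact: measurable_visits.
- exact: measurable_visits.
move=> p q; have -> : visits B x = visits A (T t x).
  by apply/seteqP; split=> s; rewrite /visits/= /B/= -!flowD addrC.
by apply/esym/eqP; apply: contra_notT Ux => pq; exists (p, q).
Qed.

(** * Sets without returns *)

Section Observable.
Variables (f : X -> R) (k : R).
Hypotheses (k0 : 0 < k) (mf : measurable_fun setT f)
  (f_lip : forall u x, `|f (T u x) - f x| <= k * `|u|).

Lemma observable_continuous x : continuous (fun u : R => f (T u x)).
Proof.
move=> u; apply/cvgrPdist_le => e e0; near=> v.
rewrite -[in f (T u x)](subrK v u) flowD.
apply: le_trans (f_lip _ _) _; rewrite -ler_pdivlMl//.
by near: v; apply: cvgr_dist_le => //; rewrite mulr_gt0// invr_gt0.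
Unshelve. all: by end_near. Qed.

(** On [F (n, q)] the value of [f] is known up to [kap n], whereas [T t]
    changes it by more than [4 * kap n].  A return at a time within
    [kap n / k] of [t] would allow a change of less than
    [2 * kap n + kap n] only. *)
Lemma observable_no_return t : (0 < m [set x | f (T t x) != f x])%E ->
  exists E e, [/\ orbit_open E, (0 < m E)%E, 0 < e & no_return E (ball t e)].
Proof.
move=> dF.
pose kap (n : nat) : R := n.+1%:R^-1.
have kap0 n : 0 < kap n by rewrite invr_gt0.
pose F (z : nat * rat) := [set x | `|f x - ratr z.2| < kap z.1] `&`
                          [set x | 4 * kap z.1 < `|f (T t x) - f x|].
have mft : measurable_fun setT (fun x => f (T t x)).
  by apply: (measurableT_comp mf); exact: measurable_act.
have oF z : orbit_open (F z).
  split.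
    apply: measurableI; rewrite -[X in measurable X]setTI.
      rewrite (_ : [set x | _] = (fun x => `|f x - ratr z.2|) @^-1` `]-oo, kap z.1[).
        apply: (measurableT_comp (f := @Num.norm R R) (g := fun x => f x - ratr z.2)) => //.
        exact: measurable_funB.
      by apply/seteqP; split=> x /=; rewrite in_itv.
    rewrite (_ : [set x | _] = (fun x => `|f (T t x) - f x|) @^-1` `]4 * kap z.1, +oo[).
      apply: (measurableT_comp (f := @Num.norm R R) (g := fun x => f (T t x) - f x)) => //.
      exact: measurable_funB.
    by apply/seteqP; split=> x /=; rewrite in_itv/= andbT.
  move=> x; have cf := @observable_continuous x.
  have cft : continuous (fun u : R => f (T t (T u x))).
    rewrite (_ : (fun u : R => _) = (fun u => f (T u x)) \o (fun u => t + u)).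
      move=> u; apply: (@continuous_comp R R R (fun u => t + u)); last exact: cf.
      by apply: continuousD => //; exact: cvg_cst.
    by apply/funext => v; rewrite /= flowD.
  apply: openI.
    apply: (@open_comp _ _ (fun u : R => `|f (T u x) - ratr z.2|) [set y | y < _]).
      by move=> u _; apply: cvg_norm; apply: cvgB; [exact: cf|exact: cvg_cst].
    exact: open_lt.
  apply: (@open_comp _ _ (fun u : R => `|f (T t (T u x)) - f (T u x)|) [set y | _ < y]).
    by move=> u _; apply: cvg_norm; apply: cvgB; [exact: cft|exact: cf].
  exact: open_gt.
have mF z : measurable (F z) by have [] := oF z.
have : (0 < m (\bigcup_z F z))%E.
  apply: lt_le_trans dF _; apply: le_measure; rewrite ?inE.
  - pose h x := f (T t x) - f x.
    have -> : [set x | f (T t x) != f x] = setT `&` h @^-1` (~` [set 0]).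
      by rewrite setTI; apply/seteqP; split=> x; rewrite /= /h -subr_eq0 => /eqP.
    apply: (measurable_funB mft mf) => //.
    by apply: measurableC; exact: measurable_set1.
  - exact: countable_bigcupT_measurable.
  - move=> x /=; rewrite -subr_eq0 -normr_gt0 => fx.
    pose n := Num.truncn (`|f (T t x) - f x| / 4)^-1.
    have nh : kap n < `|f (T t x) - f x| / 4.
      by rewrite invf_plt ?posrE ?divr_gt0// truncnS_gt.
    have [q] := @rat_in_itvoo R (f x - kap n) (f x + kap n) ltac:(have := kap0 n; lra).
    rewrite in_itv/= => /andP[q1 q2]; exists (n, q) => //; split=> /=; last lra.
    by rewrite ltr_norml; apply/andP; split; lra.
move=> /(bigcup_measure_gt0 mF)[[n q] F0].
exists (F (n, q)), (kap n / k); split => //; first by rewrite divr_gt0.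
move=> x s; rewrite /ball/= => ts [/= fx fxt] [/= fs _].
have := f_lip (t - s) (T s x); rewrite -flowD subrK.
have : k * `|t - s| < kap n by rewrite mulrC -ltr_pdivlMr.
move: fx fs; rewrite !ltr_norml ler_norml => h1 h2 h3 h4.
move: fxt; rewrite ltNge => /negP; apply; rewrite ler_norml; lra.
Qed.

End Observable.

Hypotheses (T_aper : aperiodic_flow m T) (T_erg : ergodic_flow m T).

Lemma local_no_return t : t != 0 ->
  exists E e, [/\ orbit_open E, (0 < m E)%E, 0 < e & no_return E (ball t e)].
Proof.
move=> t0; have [A mA AtA] := T_aper t0.
have [p [q pq]] := window_displaced mA AtA.
apply: (@observable_no_return (fun x => window (visits A x) p q) 2) => //.
- exact: measurable_fun_window.
- by move=> u x; exact: window_act_lipschitz.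
Qed.

(** The radius [e t] depends on [t] alone, not on the set that has been
    shrunk so far: translates of one fixed set [E] serve for every such set.
    That is what makes the covering argument possible. *)
Lemma no_return_set (a b : R) : 0 < a ->
  exists A, [/\ orbit_open A, (0 < m A)%E & no_return A [set t | a <= t <= b]].
Proof.
move=> a0.
have /choice[e eP] : forall t : R, exists e : R, t != 0 -> 0 < e /\
    exists E, [/\ orbit_open E, (0 < m E)%E & no_return E (ball t e)].
  move=> t; have [->|/local_no_return[E [e [oE E0 e0 nrE]]]] := eqVneq t 0.
    by exists 0.
  by exists e => _; split => //; exists E.
have step (s : seq R) : (forall t, t \in s -> t != 0) ->
    exists A, [/\ orbit_open A, (0 < m A)%E &
      forall t, t \in s -> no_return A (ball t (e t))].
  elim: s => [|t s IH] ts.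
    exists setT; split => //.
      by split => // x; exact: openT.
    by have -> : m setT = 1%E := probability_setT m.
  have [|A [oA A0 nrA]] := IH.
    by move=> u us; apply: ts; rewrite in_cons us orbT.
  have [|_ [E [oE E0 nrE]]] := eP t; first by apply: ts; rewrite mem_head.
  have [u AE0] := orbit_open_meet T_erg oA oE A0 E0.
  exists (A `&` T u @^-1` E); split => //.
    by apply: orbit_openI => //; exact: orbit_open_preimage.
  move=> v; rewrite in_cons => /orP[/eqP ->|vs] x r tr [Ax Ex] [Arx Erx].
    apply: (nrE (T u x) r tr Ex); move: Erx; rewrite /=.
    by rewrite -!flowD addrC.
  exact: (nrA v vs x r tr Ax).
have : compact `[a, b]%classic := @segment_compact R a b.
rewrite compact_cover => /(_ R `[a, b]%classic (fun t => ball t (e t))) [].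
- by move=> t _; exact: ball_open.
- move=> t abt; exists t => //; apply: ballxx.
  have [] := eP t => //; move: abt; rewrite /= in_itv/=; lra.
move=> D Dab cov.
have [|A [oA A0 nrA]] := step (finmap.enum_fset D).
  by move=> t /Dab; rewrite inE /= in_itv/= => /andP[ht _]; rewrite gt_eqF//; lra.
exists A; split => // x t abt.
have [|s sD ts] := cov t; first by rewrite /= in_itv.
exact: (nrA s sD x t ts).
Qed.

(** * Sets with thin neighbourhoods along the flow *)

(** [D] consists of the points reaching a set without returns before the time
    [L * 2 ^ n], and [V] allows twice this time; [n] is the first index at
    which the measure of [D] exceeds [c]. *)
Lemma thin_set (c L : R) : 0 < c < 1 -> 0 < L ->
  exists D V, [/\ measurable D, measurable V, c < fine (m D) <= 3 * c,
    fine (m V) <= 9 * c &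
    forall x, ~ V x -> visits D x `<=` [set t | L <= `|t|]].
Proof.
move=> /andP[c0 c1] L0.
(* N > 1 / c translates push the measure at time L below c *)
pose N := (Num.truncn c^-1).+1.
have [A [oA A0 nrA]] := no_return_set (4 * L * N%:R) L0.
have N0 : 0 < N%:R :> R by [].
have hL : fine (m (hit A L)) <= c.
  have := no_return_hit oA L0 nrA.
  have : 1 < N%:R * c by rewrite -ltr_pdivrMr// div1r truncnS_gt.
  move=> h1 h2; rewrite leNgt; apply/negP => h3.
  have : N%:R * c < N%:R * fine (m (hit A L)) by rewrite ltr_pM2l.
  lra.
pose S n : R := 2 ^+ n * L.
have ndS : nondecreasing_seq S.
  by move=> n k nk; rewrite ler_pM2r// ler_eXn2l// ltr1n.
have cofS r : exists n, r <= S n.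
  exists (Num.truncn (r / L)).+1; rewrite -ler_pdivrMr// ltW//.
  apply: lt_le_trans (truncnS_gt _) _.
  by rewrite -natrX ler_nat ltnW// ltn_expl.
have ex := hit_cvg T_erg oA A0 ndS cofS c1.
case: (ex_minnP ex) => -[|n] Hn minn.
  by move: Hn; rewrite /S expr0 mul1r; lra.
have nle : fine (m (hit A (S n))) <= c.
  by rewrite leNgt; apply/negP => /minn; rewrite ltnn.
have SE k : S k.+1 = 2 * S k by rewrite /S exprS mulrA.
have h1 := hit_double (S n) oA.
have h2 := hit_double (S n.+1) oA.
rewrite -!SE in h1 h2.
exists (hit A (S n.+1)), (hit A (S n.+2)); split.
- exact: measurable_hit.
- exact: measurable_hit.
- by rewrite Hn /=; lra.
- by lra.
move=> x nV t Dt; rewrite /= leNgt; apply/negP => tL; apply: nV.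
apply: (@le_hit A (S n.+1 + `|t|)); last exact: hit_preimage.
have S1 : L <= S n.+1 by rewrite /S ler_peMl ?exprn_ege1 ?ler1n ?ltW.
by rewrite (SE n.+1); lra.
Qed.

(** * Gliding hump *)

Section GlidingHump.
Variables (nu : nat -> probability RB R) (a : nat -> R).
Hypothesis (a_cvg : a @ \oo --> (0 : R)).

Lemma perturb A (r : R) (N : nat) : measurable A -> 0 < r ->
  exists B n, [/\ measurable B, fine (m (A `+` B)) <= r, (N <= n)%N &
    ((a n)%:E < discrepancy (nu n) B)%E].
Proof.
(* 3c <= r keeps D small, 9c <= 1/2 is what discrepancy_lower needs of V *)
move=> mA r0; pose c := Num.min r 1 / 20.
have c01 : 0 < c < 1.
  by rewrite /c; case: (leP r 1) => ?; apply/andP; split; lra.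
have cr : 3 * c <= r by rewrite /c; case: (leP r 1) => ?; lra.
have c2 : 9 * c <= 2^-1 by rewrite /c; case: (leP r 1) => ?; lra.
have /andP[c0 _] := c01.
have [n Nn an] : exists2 n, (N <= n)%N & a n < c / 8.
  have nb : nbhs (0 : R) [set y | y < c / 8].
    by apply: open_nbhs_nbhs; split; [exact: open_lt|rewrite /=; lra].
  have [k _ kP] := a_cvg nb.
  exists (maxn N k); first exact: leq_maxl.
  by apply: kP; rewrite /= leq_maxr.
have [L L0 nuL] := @tight R (nu n) (c / 2) ltac:(lra).
have [D [V [mD mV Dc Vc VD]]] := thin_set c01 L0.
have mK := @measurable_far R L.
have low := discrepancy_lower mD mV mK VD nuL (le_trans Vc c2).
have up := discrepancy_setU_setD (nu n) mA mD.
have near B : measurable B -> A `+` B `<=` D -> fine (m (A `+` B)) <= r.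
  move=> mB ABD; have := le_fine_prob m (measurable_setY mA mB) mD ABD; lra.
have [hU|hU] := ltP (a n)%:E (discrepancy (nu n) (A `|` D)).
  exists (A `|` D), n; split => //; first exact: measurableU.
  apply: near; first exact: measurableU.
  by move=> x; rewrite setY_def => -[[Ax /not_orP[]]//|[[]//]].
have [hD|hD] := ltP (a n)%:E (discrepancy (nu n) (A `\` D)).
  exists (A `\` D), n; split => //; first exact: measurableD.
  apply: near; first exact: measurableD.
  move=> x; rewrite setY_def => -[[Ax /not_andP[//|/contrapT//]]|[[]//]].
(* (c - c/2) / 2 = c/4 would be at most 2 * a n < c/4 *)
exfalso; have := le_trans low (le_trans up (leeD hU hD)).
by rewrite -EFinD lee_fin; lra.
Qed.

Lemma perturb_stable A (r : R) (N : nat) : measurable A -> 0 < r ->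
  exists B n s, [/\ measurable B, fine (m (A `+` B)) <= r, (N <= n)%N, 0 < s &
    forall C, measurable C -> fine (m (B `+` C)) <= s ->
      ((a n)%:E < discrepancy (nu n) C)%E].
Proof.
move=> mA r0; have [B [n [mB AB Nn h]]] := perturb N mA r0.
have [y ay yB] : exists2 y : R, a n < y & (y%:E <= discrepancy (nu n) B)%E.
  case: (discrepancy (nu n) B) h => [y|_|//]; first by rewrite lte_fin; exists y.
  by exists (a n + 1); [rewrite ltrDl|rewrite leey].
exists B, n, ((y - a n) / 4); split => //; first by rewrite divr_gt0// subr_gt0.
move=> C mC BC.
have := le_trans yB (discrepancy_setY (nu n) mB mC).
rewrite -[m _]fineK ?fin_num_measure//; last exact: measurable_setY.
rewrite -EFinM -leeBlDr// -EFinB => /(lt_le_trans _); apply.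
by rewrite lte_fin; lra.
Qed.

End GlidingHump.
End Flow.

Theorem theorem1 (R : realType) (d : measure_display) (X : measurableType d)
  (m : probability X R) (T : R -> X -> X)
  (T_flow : measurable_flow T)
  (T_pres : preserves_measure m T)
  (T_erg : ergodic_flow m T)
  (T_aper : aperiodic_flow m T)
  (nu : nat -> probability (measurableTypeR R) R)
  (a : nat -> R) (a_gt0 : forall n, 0 < a n) (a_cvg : a @ \oo --> (0 : R))
  (A' : set X) (mA' : measurable A') (A'_gt0 : (0 < m A')%E)
  (eps : R) (eps_gt0 : 0 < eps) :
  exists A : set X,
    [/\ measurable A,
        (m (A' `+` A) < eps%:E)%E
      & infinite_set [set n : nat |
          ((a n)%:E < 'N[m]_1[ (fun x =>
            (flow_average (nu n) T \1_A x - fine (m A))%:E) ])%E]].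
Proof.
(* A state records a set, a radius of stability and an index at which the
   bound fails throughout that radius; the index of the initial state is a
   dummy.  Halving the radii keeps the limit within each of them. *)
pose good (z : set X * R * nat) := measurable z.1.1 /\ 0 < z.1.2.
pose next (z w : set X * R * nat) := [/\ good w, w.1.2 <= z.1.2 / 2,
  fine (m (z.1.1 `+` w.1.1)) <= z.1.2 / 2, (z.2 < w.2)%N &
  forall C, measurable C -> fine (m (w.1.1 `+` C)) <= w.1.2 ->
    ((a w.2)%:E < discrepancy m T (nu w.2) C)%E].
have /choice[f fP] : forall z, exists w, good z -> next z w.
  move=> [[A r] N]; have [[/= mA r0]|ngood] := pselect (good (A, r, N)); last first.
    by exists (A, r, N).
  have [B [n [s [mB AB Nn s0 sP]]]] := perturb_stable T_flow T_pres T_aper T_erg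
    nu a_cvg N.+1 mA (divr_gt0 r0 (ltr0Sn _ 1)).
  exists (B, Num.min s (r / 2), n) => _; split => //=.
  - by split => //=; rewrite lt_min s0 divr_gt0.
  - by rewrite ge_min lexx orbT.
  - move=> C mC; rewrite le_min => /andP[BC _]; exact: sP.
pose z k := iter k f (A', eps / 2, 0%N).
have zgood k : good (z k).
  elim: k => [|k IH]; first by split => //=; rewrite divr_gt0.
  by have [] := fP _ IH.
have zP k : next (z k) (z k.+1) by apply: fP.
pose F k := (z k).1.1.
have mF k : measurable (F k) by have [] := zgood k.
have zr k j : (z (k + j)%N).1.2 <= (z k).1.2 / 2 ^+ j.
  elim: j => [|j IH]; first by rewrite addn0 expr0 divr1.
  have [_ h _ _ _] := zP (k + j)%N; rewrite addnS; apply: le_trans h _.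
  by rewrite exprSr invfM mulrA ler_pM2r.
have Fnear k : fine (m (F k `+` lim_sup_set F)) <= (z k).1.2.
  apply: lim_sup_set_near => // [j|]; last by have [_ /ltW] := zgood k.
  have [_ _ h _ _] := zP (k + j)%N; rewrite addnS; apply: le_trans h _.
  by rewrite exprSr invfM mulrA ler_pM2r.
have mA := measurable_lim_sup_set mF.
exists (lim_sup_set F); split => //.
  have mY := measurable_setY mA' mA.
  rewrite -[m _]fineK ?fin_num_measure// lte_fin.
  by have := Fnear 0%N; rewrite /F /=; lra.
pose u k := (z k.+1).2.
have uS k : (u k < u k.+1)%N by have [] := zP k.+1.
have u_inj : injective u by exact/incn_inj/leq_mono/(homo_ltn ltn_trans uS).
move=> /(finite_preimage (f := u) (in2W u_inj)) fin.
apply: infinite_nat; apply: sub_finite_set fin.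
move=> k _ /=; have [_ _ _ _ h] := zP k.
exact: h mA (Fnear k.+1).
Qed.
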